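(* Let $f\colon\mathbb{R}^d\to\mathbb{R}$ be a CPWL function, $\mathcal{C}$ a polyhedral complex in $\mathbb{R}^d$, and $(g,h)\in\mathcal{D}_{\mathcal{C}}(f)$. Then the decomposition $(g,h)$ is reduced if and only if $(g,h)$ is contained in a bounded face of the polyhedron $\mathcal{D}_{\mathcal{C}}(f)$.
   Context: A polyhedral complex $\mathcal{C}$ in $\mathbb{R}^d$ is a finite collection of polyhedra containing $\emptyset$, closed under taking faces, such that any two members intersect in a common face. All polyhedral complexes are assumed pure of dimension $d$ and complete (the union of the members is $\mathbb{R}^d$). A function $f\colon\mathbb{R}^d\to\mathbb{R}$ is CPWL (continuous and piecewise linear) if there is such a complex $\mathcal{C}$ with $f$ affine on every member of $\mathcal{C}$; then $f$ and $\mathcal{C}$ are called compatible. $\mathrm{Aff}(\mathbb{R}^d)$ is the space of affine functions. $\mathcal{V}_{\mathcal{C}}$ is the (finite-dimensional) vector space of CPWL functions compatible with $\mathcal{C}$, $\overline{\mathcal{V}}_{\mathcal{C}}=\mathcal{V}_{\mathcal{C}}/\mathrm{Aff}(\mathbb{R}^d)$, and $\overline{\mathcal{V}}_{\mathcal{C}}^{+}\subseteq\overline{\mathcal{V}}_{\mathcal{C}}$ is the polyhedral cone of classes of convex functions. The decomposition polyhedron of $f$ with respect to $\mathcal{C}$ is $\mathcal{D}_{\mathcal{C}}(f)=\{(g,h)\mid g,h\in\overline{\mathcal{V}}_{\mathcal{C}}^{+},\ f=g-h\}$ (equality modulo affine functions); it is a polyhedron in $\overline{\mathcal{V}}_{\mathcal{C}}\times\overline{\mathcal{V}}_{\mathcal{C}}$.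 A decomposition $(g,h)\in\mathcal{D}_{\mathcal{C}}(f)$ is called reduced if there is no $\phi\in\overline{\mathcal{V}}_{\mathcal{C}}^{+}\setminus\{0\}$ such that $g-\phi$ and $h-\phi$ are both convex. *)

(* Defs.v *)
From HB Require Import structures.
From mathcomp Require Import all_boot all_order all_algebra.
From mathcomp Require Import all_classical all_reals all_analysis.

Set Implicit Arguments.
Unset Strict Implicit.
Unset Printing Implicit Defensive.

Import Order.TTheory GRing.Theory Num.Theory.
Import numFieldNormedType.Exports.

Local Open Scope classical_set_scope.
Local Open Scope ring_scope.
Local Open Scope quotient_scope.

(* Polyhedra and faces are defined in an arbitrary real vector space, as they
   are needed both in R^d and in the space of pairs of classes of functions. *)
Section polyhedra.
Variables (R : realType) (W : lmodType R).
Implicit Types P F A : set W.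

Definition is_polyhedron P :=
  exists (n : nat) (l : 'I_n -> {linear W -> R^o}) (c : 'I_n -> R),
    P = [set x | forall i, l i x <= c i].

(* [l = 0] makes [P] a face of itself ([c = 0]) and [set0] a face of [P]
   ([c = 1]). *)
Definition is_face P F :=
  exists (l : {linear W -> R^o}) (c : R),
    (forall x, P x -> l x <= c) /\ F = P `&` [set x | l x = c].

(* All norms on a finite-dimensional space are equivalent, so boundedness can be
   tested in the coordinates of any one basis. *)
Definition bounded_in_coord A :=
  exists (n : nat) (phi : {linear W -> 'rV[R]_n}),
    bijective phi /\ bounded_set (phi @` A).

Definition affine_hull P : set W :=
  [set x | exists (n : nat) (a : 'I_n -> R) (p : 'I_n -> W),
    [/\ forall i, P (p i), \sum_i a i = 1 & x = \sum_i a i *: p i]].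

End polyhedra.

Section complexes.
Variables (R : realType) (d : nat).
Implicit Types (P Q : set 'rV[R]_d) (f : 'rV[R]_d -> R^o).

Definition has_dim P (k : nat) :=
  exists (p : 'rV[R]_d) (U : {vspace 'rV[R]_d}),
    affine_hull P = [set x | x - p \in U] /\ \dim U = k.

Record polyComplex := PolyComplex {
  cells :> set (set 'rV[R]_d);
  cells_finite : finite_set cells;
  cells_polyhedron : forall P, cells P -> is_polyhedron P;
  cells_set0 : cells set0;
  cells_face : forall P F, cells P -> is_face P F -> cells F;
  cells_meet : forall P Q, cells P -> cells Q ->
    is_face P (P `&` Q) /\ is_face Q (P `&` Q);
  cells_pure : forall P, cells P ->
    (forall Q, cells Q -> P `<=` Q -> Q = P) -> has_dim P d;
  cells_complete : \bigcup_(P in cells) P = setT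
}.

Definition affine_fun f :=
  exists (l : {linear 'rV[R]_d -> R^o}) (c : R), forall x, f x = l x + c.

(* Continuity is not required separately: the members of a complex form a finite
   closed cover of R^d. *)
Definition compatible (C : polyComplex) f :=
  forall P, cells C P ->
    exists2 a : 'rV[R]_d -> R^o, affine_fun a & forall x, P x -> f x = a x.

Definition cpwl f := exists C : polyComplex, compatible C f.

End complexes.

Section function_spaces.
Variables (R : realType) (d : nat).
Implicit Type C : polyComplex R d.

Lemma affine_fun_lin (k : R) (f g : 'rV[R]_d -> R^o) :
  affine_fun f -> affine_fun g -> affine_fun (k *: f + g).
Proof.
move=> [l [a fE]] [m [b gE]].
exists ((k \*: l) \+ m), (k * a + b) => x.
rewrite -[LHS]/(k * f x + g x) fE gE -[X in _ = X + _]/(k * l x + m x).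
by rewrite mulrDr addrACA.
Qed.

Lemma affine_fun0 : affine_fun (0 : 'rV[R]_d -> R^o).
Proof. by exists \0, 0 => x; rewrite addr0. Qed.

Definition compatible_pred C : {pred 'rV[R]_d -> R^o} :=
  fun f => `[< compatible C f >].

Lemma compatible_submod C : submod_closed (compatible_pred C).
Proof.
split=> [|k f g /asboolP fC /asboolP gC]; apply/asboolP.
  by move=> P _; exists 0 => //; exact: affine_fun0.
move=> P PC; have [a aA fa] := fC P PC; have [b bA gb] := gC P PC.
exists (k *: a + b); first exact: affine_fun_lin.
by move=> x Px; rewrite -[LHS]/(k *: f x + g x) fa // gb.
Qed.

HB.instance Definition _ C :=
  GRing.isSubmodClosed.Build R ('rV[R]_d -> R^o) (compatible_pred C)
    (compatible_submod C).

(* The vector space V_C. *)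
Record cpwlSpace C := CpwlSpace {
  cpwl_fun :> 'rV[R]_d -> R^o;
  cpwl_funP : cpwl_fun \in compatible_pred C
}.

HB.instance Definition _ C := [isSub for @cpwl_fun C].
HB.instance Definition _ C := [Choice of cpwlSpace C by <:].
HB.instance Definition _ C := [SubChoice_isSubLmodule of cpwlSpace C by <:].

Definition affine_pred C : {pred cpwlSpace C} :=
  fun u => `[< affine_fun (cpwl_fun u) >].

Lemma affine_submod C : submod_closed (@affine_pred C).
Proof.
split=> [|k u v /asboolP uA /asboolP vA]; apply/asboolP.
  exact: affine_fun0.
exact: affine_fun_lin.
Qed.

HB.instance Definition _ C :=
  GRing.isSubmodClosed.Build R (cpwlSpace C) (@affine_pred C)
    (@affine_submod C).

(* The quotient of V_C by Aff(R^d); the library only equips [{quot _}] with an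
   additive group structure, so the scaling is added below. *)
Definition cpwlQuot C : Type := Quotient.quot (@affine_pred C).

HB.instance Definition _ C := GRing.Zmodule.on (cpwlQuot C).

Definition cls C (u : cpwlSpace C) : cpwlQuot C :=
  \pi_(Quotient.quot (@affine_pred C)) u.

Lemma clsP C (u v : cpwlSpace C) :
  cls u = cls v <-> affine_fun (cpwl_fun (u - v)).
Proof.
by split=> [/eqP|uv]; [|apply/eqP]; rewrite /cls -Quotient.idealrBE;
  [move/asboolP | apply/asboolP].
Qed.

Lemma clsB C : zmod_morphism (@cls C).
Proof. exact: pi_is_zmod_morphism. Qed.

HB.instance Definition _ C :=
  GRing.isZmodMorphism.Build (cpwlSpace C) (cpwlQuot C) (@cls C) (@clsB C).

Definition rep C (q : cpwlQuot C) : cpwlSpace C :=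
  repr (q : Quotient.quot (@affine_pred C)).

Lemma repK C : cancel (@rep C) (@cls C).
Proof. exact: reprK. Qed.

Definition scaleq C (k : R) (q : cpwlQuot C) : cpwlQuot C := cls (k *: rep q).

Lemma scaleq_cls C (k : R) (u : cpwlSpace C) :
  scaleq k (cls u) = cls (k *: u).
Proof.
apply/clsP; rewrite -scalerBr -[k *: _]addr0.
apply: affine_fun_lin affine_fun0; apply/clsP; exact: repK.
Qed.

Lemma scaleqA C (a b : R) (q : cpwlQuot C) :
  scaleq a (scaleq b q) = scaleq (a * b) q.
Proof. by rewrite -[q]repK !scaleq_cls scalerA. Qed.

Lemma scale1q C : left_id 1 (@scaleq C).
Proof. by move=> q; rewrite -[q]repK scaleq_cls scale1r. Qed.

Lemma scaleqDr C : right_distributive (@scaleq C) +%R.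
Proof.
move=> k p q; rewrite -[p]repK -[q]repK -raddfD !scaleq_cls.
by rewrite scalerDr raddfD.
Qed.

Lemma scaleqDl C (q : cpwlQuot C) : {morph (@scaleq C)^~ q : a b / a + b}.
Proof. by move=> a b; rewrite -[q]repK !scaleq_cls scalerDl raddfD. Qed.

HB.instance Definition _ C := GRing.Zmodule_isLmodule.Build R (cpwlQuot C)
  (@scaleqA C) (@scale1q C) (@scaleqDr C) (@scaleqDl C).

Lemma cls_scalable C : scalable (@cls C).
Proof. by move=> k u; rewrite -scaleq_cls. Qed.

HB.instance Definition _ C :=
  GRing.isScalable.Build R (cpwlSpace C) (cpwlQuot C) *:%R (@cls C)
    (@cls_scalable C).

Definition convex_cone C : set (cpwlQuot C) :=
  [set q | exists2 u : cpwlSpace C,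
    @convex_function R 'rV[R]_d setT (cpwl_fun u) & q = cls u].

(* Empty when [f] is not compatible with [C], as the equality modulo affine
   functions of [f] and [g - h] then cannot hold. *)
Definition decomposition_polyhedron C (f : 'rV[R]_d -> R^o) :
    set (cpwlQuot C * cpwlQuot C)%type :=
  [set gh | [/\ convex_cone gh.1, convex_cone gh.2 &
    exists2 u : cpwlSpace C, cpwl_fun u = f & cls u = gh.1 - gh.2]].

Definition reduced C (gh : cpwlQuot C * cpwlQuot C) :=
  ~ exists phi : cpwlQuot C, [/\ convex_cone phi, phi <> 0,
      convex_cone (gh.1 - phi) & convex_cone (gh.2 - phi)].

End function_spaces.

Arguments decomposition_polyhedron {R d} C f.

(* Main.v *)
From HB Require Import structures.
Require Import Defs.
From mathcomp Require Import all_boot all_order all_algebra.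
From mathcomp Require Import all_classical all_reals all_analysis.
From mathcomp Require Import ring.

(** Write [K] for the cone of classes of convex functions and [D] for the
    decomposition polyhedron, the pairs [(g, h)] in [K * K] with [g - h] equal
    to the class of [f].  Adding the same [phi] of [K] to both components of a
    point of [D] stays in [D], so the diagonal copy of [K] consists of recession
    directions of [D]; being reduced means that no step back along such a
    direction stays in [D].

    If a pair of a bounded face can be moved back by a nonzero [phi], it lies
    inside a segment of [D] of direction [(phi, phi)], hence the linear form
    that defines the face vanishes on [(phi, phi)], and the face contains a
    whole half-line: this contradicts boundedness ([bounded_face_reduced]).

    Conversely, suppose that [K] is given by finitely many inequalities
    [0 <= l t q].  The sum of those that are tight at [g] or at [h], in the
    respective component, defines a face [F] through [(g, h)].  A nonzero
    recession direction of [F] would have the form [(phi, phi)] with [phi] in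
    [K] and [l t phi = 0] for every tight [t]; a small multiple of [phi] could
    then be subtracted from both [g] and [h].  If [(g, h)] is reduced there is
    no such direction, and compactness of the unit sphere bounds [F]
    ([reduced_bounded_face]).

    What remains is that the space of classes is finite dimensional
    ([cpwlQuot_coordinates]) and that [K] is polyhedral ([convex_cone_ineqs]).
    Let [a_P] be the affine function that agrees with [u] on a full-dimensional
    cell [P].  Then [u] is convex exactly when [a_P <= u] everywhere for every
    [P] ([convex_fullP]), since [u] is then the maximum of the [a_P].  This
    says that [a_Q - a_P] is nonnegative on [Q] for all full-dimensional [P] and
    [Q]: infinitely many inequalities, linear in [u] and affine in the point of
    [Q].  As the polyhedron [Q] is generated by finitely many points and
    directions, finitely many of them suffice ([polyhedron_test]).  This
    criterion compares all pairs of cells and so avoids any analysis of how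
    adjacent cells meet. *)

Set Implicit Arguments.
Unset Strict Implicit.
Unset Printing Implicit Defensive.

Import Order.TTheory GRing.Theory Num.Theory.
Import numFieldNormedType.Exports.

Local Open Scope classical_set_scope.
Local Open Scope ring_scope.

(** * Linear functionals and coordinates *)

Definition pack_linear (R : realType) (V W : lmodType R) (f : V -> W)
    (lf : linear f) : {linear V -> W} :=
  HB.pack f (GRing.isLinear.Build _ _ _ _ _ lf).

(** [functionalZ] and [functionalP] are [linearZ] and [linearP] with the
    scaling of [R^o] displayed as the product of [R], so that field reasoning
    applies after rewriting. *)
Lemma functionalZ (R : realType) (V : lmodType R) (l : {linear V -> R^o})
  (a : R) x : l (a *: x) = a * l x.
Proof. exact: linearZ. Qed.

Lemma functionalP (R : realType) (V : lmodType R) (l : {linear V -> R^o})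
  (a : R) x y : l (a *: x + y) = a * l x + l y.
Proof. exact: linearP. Qed.

(** Finitely many functionals that separate points embed [W] in a space of row
    vectors, and the image of [W] is a subspace: coordinates with respect to a
    maximal free family of this image form a linear bijection. *)
Lemma coordinates_of_separating (R : realType) (W : lmodType R) (T : finType)
    (L : T -> {linear W -> R^o}) :
  (forall w, (forall t, L t w = 0) -> w = 0) ->
  exists (m : nat) (phi : {linear W -> 'rV[R]_m}), bijective phi.
Proof.
move=> sepL.
have psi_lin : linear (fun w => \row_(i < #|T|) (L (enum_val i) w : R)).
  by move=> k v w; apply/rowP => i; rewrite !mxE linearP.
pose psi := pack_linear psi_lin.
have psi_inj : injective psi.
  apply: raddf_inj => w /rowP psiw0; apply: sepL => t.
  by have := psiw0 (enum_rank t); rewrite !mxE enum_rankK.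
pose P k := `[< exists w : 'I_k -> W, row_free (\matrix_i psi (w i)) >].
have P0 : exists k, P k.
  exists 0; apply/asboolP; exists (fun=> 0).
  by rewrite /row_free -leqn0 rank_leq_row.
have Pn k : P k -> (k <= #|T|)%N.
  by move=> /asboolP[w /eqP <-]; exact: rank_leq_col.
case: (ex_maxnP P0 Pn) => k /asboolP[w wfree] kmax.
set B := \matrix_i psi (w i) in wfree.
(* Otherwise [psi v] could be added to the maximal free family [B]. *)
have psiB v : (psi v <= B)%MS.
  apply: contraT => vB; suff /kmax : P k.+1 by rewrite ltnn.
  apply/asboolP.
  exists (fun i : 'I_k.+1 => if unlift ord0 i is Some j then w j else v).
  set B' := \matrix_i _.
  have -> : B' = col_mx (psi v) B :> 'M[R]_(1 + k, #|T|).
    apply/row_matrixP => i; rewrite rowK.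
    case: (@split_ordP 1 k i) => j ->; rewrite ?rowKu ?rowKd.
      rewrite (_ : lshift k j = ord0 :> 'I_k.+1) ?unlift_none /=.
        by rewrite (ord1 j) row_id.
      by apply: val_inj; rewrite (ord1 j).
    rewrite (_ : rshift 1 j = lift ord0 j :> 'I_k.+1) ?liftK ?rowK //.
    exact: val_inj.
  have /rank_ltmx : (B < col_mx (psi v) B)%MS.
    rewrite ltmxE col_mx_sub (negPf vB) andbT.
    by have := submx_refl (col_mx (psi v) B); rewrite col_mx_sub => /andP[].
  by rewrite (eqP wfree) -row_leq_rank.
have phi_lin : linear (fun v => psi v *m pinvmx B).
  by move=> a v v'; rewrite linearP mulmxDl scalemxAl.
exists k, (pack_linear phi_lin), (fun r : 'rV[R]_k => \sum_i r 0 i *: w i).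
  move=> v; apply: psi_inj; rewrite -[RHS](mulmxKpV (psiB v)).
  rewrite linear_sum mulmx_sum_row; apply: eq_bigr => i _.
  by rewrite linearZ rowK.
move=> r; rewrite -[RHS]mulmx1 -(mulmxVp wfree) mulmxA; congr (_ *m _).
rewrite linear_sum mulmx_sum_row; apply: eq_bigr => i _.
by rewrite linearZ rowK.
Qed.

(** * Finite tests for nonnegativity on a polyhedron *)

Section double_description.
Variables (R : realType) (E : lmodType R).
Implicit Types (K : set E) (s : seq E) (m : {linear E -> R^o}).

Definition conic K :=
  forall (a b : R) x y, 0 <= a -> 0 <= b -> K x -> K y -> K (a *: x + b *: y).

(** For a closed convex cone [K], conic duality says that this amounts to [s]
    generating [K].  The dual form is the one used below, and its stability
    under adding an inequality is an argument on real numbers only. *)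
Definition dual_generators K s :=
  (forall v, v \in s -> K v) /\
  forall b : {linear E -> R^o}, (forall v, v \in s -> 0 <= b v) ->
    forall x, K x -> 0 <= b x.

Lemma separating_number (A B : seq R) :
  {in A & B, forall a b, a <= b} ->
  exists2 mu, {in A, forall a, a <= mu} & {in B, forall b, mu <= b}.
Proof.
elim: A => [_|a A IH AB].
  elim: B => [|b B [mu _ muB]]; first by exists 0.
  exists (Num.min b mu) => // c; rewrite inE => /predU1P[->|/muB].
    by rewrite ge_min lexx.
  by rewrite ge_min orbC => ->.
have [|mu Amu muB] := IH.
  by move=> a' b a'A; apply: AB; rewrite inE a'A orbT.
exists (Num.max a mu) => [c|c cB]; last first.
  by rewrite ge_max muB // AB // mem_head.
by rewrite inE le_max => /predU1P[->|/Amu ->]; rewrite ?lexx ?orbT.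
Qed.

(** One step of the double description method.  The new generators are the old
    ones in the half-space and, up to scaling, the points where the segments
    joining an old generator [u] outside to an old generator [v] inside meet the
    boundary.
    Nonnegativity of [b] at these points says exactly that there is a
    multiplier [mu >= 0] for which [b + mu * m] is nonnegative at all the old
    generators, hence on [K]; and [b >= b + mu * m] where [m <= 0]. *)
Lemma dual_generators_halfspace K s m : conic K -> dual_generators K s ->
  exists s', dual_generators (K `&` [set x | m x <= 0]) s'.
Proof.
move=> Kcone [sK sgen].
pose s0 := [seq v <- s | m v <= 0]; pose s1 := [seq u <- s | 0 < m u].
exists (s0 ++ [seq m u *: v + (- m v) *: u | u <- s1, v <- s0]); split.
  move=> w; rewrite mem_cat mem_filter => /orP[/andP[mw /sK Kw] //|].
  move=> /allpairsP[[u v]] /=; rewrite !mem_filter.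
  move=> [/andP[mu /sK Ku] /andP[mv /sK Kv] ->]; split => /=.
    by apply: Kcone => //; [exact: ltW | rewrite oppr_ge0].
  by rewrite functionalP (functionalZ m) mulNr [X in _ - X]mulrC subrr.
move=> b b_ge0 x [Kx /= mx_le0].
have b0 v : v \in s -> m v <= 0 -> 0 <= b v.
  by move=> vs mv; apply: b_ge0; rewrite mem_cat mem_filter mv vs.
have b1 u v : u \in s -> v \in s -> 0 < m u -> m v <= 0 ->
    0 <= m u * b v - m v * b u.
  move=> us vs mu mv.
  have -> : m u * b v - m v * b u = b (m u *: v + (- m v) *: u).
    by rewrite functionalP (functionalZ b) mulNr.
  apply: b_ge0; rewrite mem_cat; apply/orP; right.
  by apply/allpairsP; exists (u, v); rewrite !mem_filter /= mu mv.
(* Generators with [0 < m] bound [mu] from below, those with [m < 0] bound it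
   from above, and the entry [0] makes it nonnegative. *)
have [|mu mu_ge mu_le] := @separating_number
    (0 :: [seq - b u / m u | u <- s1])
    [seq b v / - m v | v <- [seq v <- s | m v < 0]].
  move=> a c; rewrite inE => aA /mapP[v]; rewrite mem_filter => /andP[mv vs] ->.
  have mv' : 0 < - m v by rewrite oppr_gt0.
  case/predU1P: aA => [->|/mapP[u]].
    by apply: divr_ge0; [apply: b0 => //|]; exact: ltW.
  rewrite mem_filter => /andP[mu us] ->.
  rewrite ler_pdivrMr // mulrAC ler_pdivlMr //.
  have := b1 _ _ us vs mu (ltW mv); rewrite -[X in _ -> is_true X]subr_ge0.
  by congr (_ <= _); ring.
have bm_lin : linear (fun x => b x + mu * m x : R^o).
  move=> k u v /=; rewrite !functionalP /GRing.scale /=; ring.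
have mu_ge0 : 0 <= mu by apply: mu_ge; exact: mem_head.
have : 0 <= b x + mu * m x.
  apply: (sgen (pack_linear bm_lin)) => // v vs /=.
  have [mv|mv|mv] := ltgtP (m v) 0; last by rewrite mv mulr0 addr0 b0 // mv.
    have : mu <= b v / - m v.
      by apply: mu_le; apply/mapP; exists v; rewrite // mem_filter mv.
    by rewrite ler_pdivlMr ?oppr_gt0 // mulrN lerNl -subr_ge0 opprK addrC.
  have : - b v / m v <= mu.
    apply: mu_ge; rewrite inE; apply/orP; right; apply/mapP; exists v => //.
    by rewrite mem_filter mv.
  by rewrite ler_pdivrMr // -subr_ge0 opprK addrC.
move=> /le_trans; apply; rewrite gerDl.
exact: mulr_ge0_le0.
Qed.

Lemma dual_generators_polyhedral n (l : 'I_n -> {linear E -> R^o}) K s :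
  conic K -> dual_generators K s ->
  exists s', dual_generators (K `&` [set x | forall i, l i x <= 0]) s'.
Proof.
elim: n l K s => [|n IH] l K s Kcone sK.
  exists s; rewrite (_ : _ `&` _ = K) //.
  by apply/seteqP; split => [x []//|x Kx]; split => // -[].
have [s1 s1K] := dual_generators_halfspace (l ord0) Kcone sK.
have [|s2 s2K] := IH (fun i => l (lift ord0 i)) _ s1 _ s1K.
  move=> a b x y a0 b0 [Kx lx] [Ky ly]; split; first exact: Kcone.
  rewrite /= linearD !linearZ /= -[leRHS]addr0.
  by apply: lerD; exact: mulr_ge0_le0.
exists s2; rewrite (_ : _ `&` _ = K `&` [set x | l ord0 x <= 0] `&`
  [set x | forall i : 'I_n, l (lift ord0 i) x <= 0]) //.
apply/seteqP; split => [x [Kx lx]|x [[Kx l0x] lx]].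
  by split=> [|i]; [split => //|]; exact: lx.
by split=> // i; case: (unliftP ord0 i) => [j ->|->].
Qed.

End double_description.

Lemma dual_generators_full (R : realType) d :
  exists s, dual_generators [set: ('rV[R]_d * R^o)%type] s.
Proof.
pose e := [seq (delta_mx 0 i, 0) | i <- enum 'I_d] ++ [:: (0, 1)]
  : seq ('rV[R]_d * R^o)%type.
exists (e ++ map -%R e); split=> // b b_ge0 x _.
suff -> : b x = 0 by [].
have b0 v : v \in e -> b v = 0.
  move=> ve; apply/eqP; rewrite eq_le; apply/andP; split.
    by rewrite -oppr_ge0 -linearN b_ge0 // mem_cat map_f // orbT.
  by apply: b_ge0; rewrite mem_cat ve.
have -> : x = \sum_i x.1 0 i *: (delta_mx 0 i, 0) + x.2 *: (0, 1).
  case: x => x t /=.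
  have -> : \sum_i x 0 i *: (delta_mx 0 i : 'rV[R]_d, 0 : R^o) = (x, 0).
    rewrite [in RHS](row_sum_delta x); elim/big_rec2: _ => // i y1 y2 _ ->.
    rewrite [LHS]surjective_pairing /=; congr pair.
    by rewrite scaler0 add0r.
  rewrite [RHS]surjective_pairing /=; congr pair;
    rewrite ?scaler0 ?addr0 ?add0r //.
  by rewrite [_ *: 1]mulr1.
have b01 : b (0, 1) = 0 by rewrite b0 // mem_cat mem_head orbT.
rewrite linearD linear_sum (functionalZ b) b01 mulr0 addr0 big1 // => i _.
rewrite (functionalZ b) b0 ?mulr0 // mem_cat; apply/orP; left.
by apply/mapP; exists i; rewrite ?mem_enum.
Qed.

(** The values [B x q] are affine in [x]: on the cone over [Q], the closure of
    the set of [(t x, t)] with [x] in [Q] and [t > 0], they extend to a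
    linear functional.  It suffices to test this functional at the generators of
    the cone. *)
Lemma polyhedron_test (R : realType) d (W : lmodType R) (Q : set 'rV[R]_d)
    (B : 'rV[R]_d -> {linear W -> R^o}) :
  is_polyhedron Q -> (forall q, affine_fun (fun x => B x q)) ->
  exists (n : nat) (l : 'I_n -> {linear W -> R^o}),
    forall q, (forall x, Q x -> 0 <= B x q) <-> (forall i, 0 <= l i q).
Proof.
move=> [n [m [c ->]]] Baff.
have [[x0 /= Qx0]|Q0] := pselect ([set x | forall i, m i x <= c i] !=set0);
    last first.
  exists 0, (fun=> \0) => q; split=> [_ []//|_ x Qx].
  by case: Q0; exists x.
have [s0 s0T] := dual_generators_full R d.
(* The inequality [0] is [t >= 0], and the inequality [j + 1] is the
   homogenized [m j x <= c j * t]. *)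
have hom_lin i : linear (fun z : 'rV[R]_d * R^o =>
    if unlift ord0 i is Some j then m j z.1 - c j * z.2 else - z.2 : R^o).
  move=> k u v; case: unlift => [j|] /=.
    by rewrite functionalP /GRing.scale /=; ring.
  by rewrite /GRing.scale /=; ring.
have [//|s [sK sgen]] := dual_generators_polyhedral
  (fun i : 'I_n.+1 => pack_linear (hom_lin i)) _ s0T.
set K := _ `&` _ in sK sgen.
have KP z : K z <-> 0 <= z.2 /\ forall j, m j z.1 <= c j * z.2.
  split=> [[_ /= Kz]|[z0 Kz]].
    split=> [|j]; first by have := Kz ord0; rewrite unlift_none oppr_le0.
    by have := Kz (lift ord0 j); rewrite liftK subr_le0.
  split=> // i /=; case: unliftP => [j|] _; first by rewrite subr_le0.
  by rewrite oppr_le0.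
pose l (i : 'I_(size s)) := let z := nth (0, 0) s i in
  (B z.1 \+ ((z.2 - 1) \*: B 0) : {linear W -> R^o}).
exists (size s), l => q; have [a [e Be]] := Baff q.
have lE i : l i q = a (nth (0, 0) s i).1 + e * (nth (0, 0) s i).2.
  rewrite /l; set z := nth _ _ _; rewrite -[LHS]/(B z.1 q + (z.2 - 1) * B 0 q).
  by rewrite !Be linear0; ring.
split=> [B_ge0 i|l_ge0 x Qx].
  rewrite lE; have /KP := sK _ (mem_nth (0, 0) (ltn_ord i)).
  case: (nth _ _ _) => y t /= [t0 Qy].
  have aQ x : (forall j, m j x <= c j) -> 0 <= a x + e.
    by move=> /B_ge0; rewrite Be.
  move: t0; rewrite le_eqVlt => /predU1P[t0|t0]; last first.
    have : 0 <= a (t^-1 *: y) + e.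
      by apply: aQ => j; rewrite (functionalZ (m j)) mulrC ler_pdivrMr.
    rewrite (functionalZ a) => ay.
    rewrite (_ : a y + e * t = t * (t^-1 * a y + e)) ?mulr_ge0 ?(ltW t0) //.
    by field; rewrite gt_eqF.
  (* A generator at height [0] is a recession direction [y] of [Q]: if [a] were
     negative on it, [a + e] would reach [-1] on the half-line from [x0]. *)
  rewrite -t0 mulr0 addr0 leNgt; apply/negP => ay.
  have ay' : 0 < - a y by rewrite oppr_gt0.
  have r0 : 0 <= (a x0 + e + 1) / - a y.
    by apply: divr_ge0; [apply: addr_ge0 => //; exact: aQ | exact: ltW].
  have : 0 <= a (((a x0 + e + 1) / - a y) *: y + x0) + e.
    apply: aQ => j; rewrite functionalP -[leRHS]add0r lerD ?Qx0 //.
    by rewrite mulr_ge0_le0 //; have := Qy j; rewrite -t0 mulr0.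
  rewrite functionalP.
  have -> : (a x0 + e + 1) / - a y * a y + a x0 + e = -1.
    by field; rewrite lt_eqF.
  by rewrite oppr_ge0 ler10.
have b_lin : linear (fun z : 'rV[R]_d * R^o => a z.1 + e * z.2 : R^o).
  by move=> k u v /=; rewrite functionalP /GRing.scale /=; ring.
have : 0 <= a x + e * 1.
  apply: (sgen (pack_linear b_lin) _ (x, 1)) => [v vs /=|].
    have := l_ge0 (Ordinal (etrans (index_mem v s) vs)).
    by rewrite lE /= nth_index.
  by apply/KP; split=> [|j] //=; rewrite mulr1; exact: Qx.
by rewrite mulr1 Be.
Qed.

(** * Boundedness and continuity in coordinates *)

(** The infimum of [m] over the unit sphere is attained, hence positive, and
    homogeneity extends the bound to all vectors. *)
Lemma gauge_bounds_norm (R : realType) n (m : 'rV[R]_n -> R) :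
  continuous m -> (forall t x, 0 <= t -> m (t *: x) = t * m x) ->
  (forall x, x != 0 -> 0 < m x) ->
  exists2 delta, 0 < delta & forall x, delta * `|x| <= m x.
Proof.
move=> mcont mZ m_gt0.
have m0 : m 0 = 0 by rewrite -(scale0r 0) mZ ?mul0r.
pose S := [set x : 'rV[R]_n | `|x| = 1].
have norml (x : 'rV[R]_n) : x != 0 -> S (`|x|^-1 *: x).
  move=> x0; rewrite /S /= normrZ ger0_norm ?invr_ge0 //.
  by rewrite mulVf // normr_eq0.
have [S0|S0] := pselect (S !=set0); last first.
  exists 1 => // x; have [->|x0] := eqVneq x 0.
    by rewrite normr0 mulr0 m0.
  by case: S0; exists (`|x|^-1 *: x); exact: norml.
have Scompact : compact S.
  apply: bounded_closed_compact.
    exists 1; split; first by rewrite num_real.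
    by move=> M M1 x /= ->; exact: ltW.
  apply: (@closed_comp _ _ (fun x : 'rV[R]_n => `|x|) [set x | x = 1]).
    by move=> x _; exact: norm_continuous.
  exact: closed_eq.
have [|c cS cmin] := compact_EVT_min S0 Scompact (f := m).
  exact: continuous_subspaceT.
have c0 : c != 0.
  move: cS; rewrite inE /S /= => c1; apply/eqP => c0.
  by move: c1; rewrite c0 normr0 => /esym/eqP; rewrite oner_eq0.
exists (m c); first exact: m_gt0.
move=> x; have [->|x0] := eqVneq x 0; first by rewrite normr0 mulr0 m0.
have := cmin (`|x|^-1 *: x); rewrite inE => /(_ (norml _ x0)).
by rewrite mZ ?invr_ge0 // mulrC ler_pdivlMr // normr_gt0.
Qed.

Lemma norm_row_mx_le (R : realType) n1 n2 (a : 'rV[R]_n1) (b : 'rV[R]_n2) :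
  `|row_mx a b| <= `|a| + `|b|.
Proof.
have entry_le k (x : 'rV[R]_k) i j : `|x i j| <= `|x|.
  rewrite [leRHS]mx_normrE.
  exact: (le_bigmax 0 (fun ij : 'I_1 * 'I_k => `|x ij.1 ij.2|) (i, j)).
rewrite [leLHS]mx_normrE; apply: bigmax_le => [|[i j] _ /=].
  by rewrite addr_ge0.
rewrite mxE; case: splitP => k _; apply: le_trans (entry_le _ _ _ _) _.
  by rewrite lerDl.
by rewrite lerDr.
Qed.

Lemma functional_continuous (R : realType) n (l : {linear 'rV[R]_n -> R^o}) :
  continuous (l : 'rV[R]_n -> R).
Proof.
rewrite (_ : (l : _ -> _) = fun x => \sum_i x 0 i * l (delta_mx 0 i)).
  apply: continuous_big => [|i _]; first exact: add_continuous.
  by move=> x; apply: cvgM (@coord_continuous R 1 n 0 i x) _; exact: cvg_cst.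
apply/funext => x; rewrite {1}[x]row_sum_delta linear_sum.
by apply: eq_bigr => i _; exact: functionalZ.
Qed.

Lemma small_multiple_le (R : realType) (T : finType) (a b : T -> R) :
  (forall t, 0 < a t) -> exists2 e, 0 < e & forall t, e * b t <= a t.
Proof.
move=> a_gt0.
pose N := 1 + \sum_s `|b s| / a s.
have N0 : 0 < N.
  rewrite ltr_pwDl // sumr_ge0 // => s _.
  by apply: divr_ge0; [exact: normr_ge0 | exact: ltW].
exists N^-1; first by rewrite invr_gt0.
move=> t; rewrite mulrC ler_pdivrMr // mulrC -ler_pdivrMr //.
apply: (@le_trans _ _ (`|b t| / a t)).
  by rewrite ler_pM2r ?invr_gt0 // ler_norm.
rewrite /N (bigD1 t) //= addrCA lerDl addr_ge0 // sumr_ge0 // => s _.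
by apply: divr_ge0; [exact: normr_ge0 | exact: ltW].
Qed.

(** * Decompositions with respect to a polyhedral cone *)

Section cone_decompositions.
Variables (R : realType) (W : lmodType R) (T : finType).
Variables (l : T -> {linear W -> R^o}) (f : W).

Definition ineq_cone : set W := [set q | forall t, 0 <= l t q].

Definition cone_decompositions : set (W * W)%type :=
  [set gh | [/\ ineq_cone gh.1, ineq_cone gh.2 & f = gh.1 - gh.2]].

Definition reduced_pair (gh : W * W) :=
  ~ exists phi, [/\ ineq_cone phi, phi <> 0, ineq_cone (gh.1 - phi) &
      ineq_cone (gh.2 - phi)].

Lemma cone_decompositions_shift g h phi :
  cone_decompositions (g, h) -> ineq_cone (g + phi) -> ineq_cone (h + phi) ->
  cone_decompositions (g + phi, h + phi).
Proof.
by move=> [_ _ fgh] gK hK; split=> //=; rewrite opprD addrACA subrr addr0.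
Qed.

(** The form [c] is at most [e] at [(g, h) + (phi, phi)] and at
    [(g, h) - (phi, phi)], and equal to [e] in between, so it vanishes on
    [(phi, phi)]; the half-line from [(g, h)] in this direction stays in [F]. *)
Lemma bounded_face_reduced F g h :
  is_face cone_decompositions F -> bounded_in_coord F -> F (g, h) ->
  reduced_pair (g, h).
Proof.
move=> [c [e [ce ->]]] [n [psi [psi_bij psi_bnd]]] [Dgh /= cgh].
move=> [phi [phiK phi0 /= gK hK]]; apply: phi0.
have [gK' hK' _] := Dgh.
have Dshift a : 0 <= a -> cone_decompositions (g + a *: phi, h + a *: phi).
  move=> a0; apply: cone_decompositions_shift => // t; rewrite linearD.
    by rewrite addr_ge0 ?gK' // (functionalZ (l t)) mulr_ge0.
  by rewrite addr_ge0 ?hK' // (functionalZ (l t)) mulr_ge0.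
have cphi : c (phi, phi) = 0.
  apply/eqP; rewrite eq_le; apply/andP; split.
    have := ce _ (Dshift 1 ler01); rewrite scale1r.
    by rewrite -[(_, _)]/((g, h) + (phi, phi)) linearD cgh gerDl.
  have := ce _ (cone_decompositions_shift Dgh gK hK).
  by rewrite -[(_, _)]/((g, h) - (phi, phi)) linearB cgh gerBl.
have Fshift a : 0 <= a -> (psi @` (cone_decompositions `&` [set x | c x = e]))
    (psi (g, h) + a *: psi (phi, phi)).
  move=> a0; exists ((g, h) + a *: (phi, phi)); last by rewrite linearD linearZ.
  split; first exact: Dshift.
  by rewrite /= linearD (functionalZ c) cphi mulr0 addr0.
suff : psi (phi, phi) = 0.
  move=> /eqP; rewrite (raddf_eq0 _ (bij_inj psi_bij)).
  by move=> /eqP/(congr1 fst).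
apply/eqP; apply: contraT => psi0.
have [M [_ Mbnd]] := psi_bnd.
have np : 0 < `|psi (phi, phi)| by rewrite normr_gt0.
pose N := `|M| + 1; have N0 : 0 <= N by rewrite addr_ge0.
have MN : M < N by rewrite (le_lt_trans (ler_norm M)) // ltrDl.
have NB y : (psi @` (cone_decompositions `&` [set x | c x = e])) y -> `|y| <= N.
  by move=> /(Mbnd _ MN).
(* Two points of a ball of radius [N] are at distance at most [2 N], and moving
   by [a] along the direction is a step of length [2 N + 1]. *)
pose a := (N + N + 1) / `|psi (phi, phi)|.
have a0 : 0 <= a by rewrite divr_ge0 // ?addr_ge0.
have h0 := NB _ (Fshift 0 (lexx 0)); rewrite scale0r addr0 in h0.
have h1 := NB _ (Fshift a a0).
have : `|a *: psi (phi, phi)| <= N + N.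
  rewrite -[a *: _](addKr (psi (g, h))) (le_trans (ler_normD _ _)) //.
  by rewrite normrN lerD.
rewrite normrZ ger0_norm // /a mulfVK ?gt_eqF //.
by rewrite gerDl ler10.
Qed.

(** The face is the set where all the inequalities tight at [(g, h)] remain
    tight, that is, the smallest face containing [(g, h)].  It is bounded
    because [m] below is a gauge that vanishes only at the diagonal recession
    directions of that face, which are excluded as [(g, h)] is reduced. *)
Lemma reduced_bounded_face n (psi : {linear W -> 'rV[R]_n}) g h :
  bijective psi -> cone_decompositions (g, h) ->
  reduced_pair (g, h) ->
  exists F, [/\ is_face cone_decompositions F, bounded_in_coord F & F (g, h)].
Proof.
move=> psi_bij Dgh irr; have [gK hK fgh] := Dgh.
have [psiV psiK psiVK] := psi_bij.
have psiV_lin : linear psiV.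
  by move=> a x y; apply: (bij_inj psi_bij); rewrite linearP !psiVK.
pose psiVL := pack_linear psiV_lin.
pose tight t := (l t g == 0) || (l t h == 0).
have c_lin : linear (fun pq : W * W =>
    - (\sum_(t | l t g == 0) l t pq.1 + \sum_(t | l t h == 0) l t pq.2) : R^o).
  move=> a [p q] [p' q'] /=.
  rewrite (eq_bigr (fun t => a * l t p + l t p')) => [|t _];
    last exact: functionalP.
  rewrite [X in - (_ + X)](eq_bigr (fun t => a * l t q + l t q')) => [|t _];
    last exact: functionalP.
  by rewrite !big_split /= -!mulr_sumr /GRing.scale /=; ring.
pose c := pack_linear c_lin.
have c_le0 pq : cone_decompositions pq -> c pq <= 0.
  by case: pq => p q [pK qK _]; rewrite oppr_le0 addr_ge0 ?sumr_ge0.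
pose F := cone_decompositions `&` [set x | c x = 0].
have Ftight p q : F (p, q) ->
    (forall t, l t g = 0 -> l t p = 0) /\ (forall t, l t h = 0 -> l t q = 0).
  move=> [[pK qK _] /eqP]; rewrite oppr_eq0 paddr_eq0 ?sumr_ge0 //=.
  move=> /andP[]; rewrite !psumr_eq0 //.
  move=> /allP pg /allP qh; split=> t /eqP tt.
    by have := pg t; rewrite mem_index_enum tt => /(_ isT)/eqP.
  by have := qh t; rewrite mem_index_enum tt => /(_ isT)/eqP.
(* The first sum measures how far [x] is from the cone, and the second one how
   far it is from the hyperplanes of the tight inequalities. *)
pose m x : R := \sum_t (`|l t x| - l t x) + \sum_(t | tight t) `|l t x|.
have mE x : ineq_cone x -> m x = \sum_(t | tight t) `|l t x|.
  move=> xK; rewrite /m big1 ?add0r // => t _.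
  by rewrite ger0_norm ?subrr.
have m_ge0 x : 0 <= \sum_t (`|l t x| - l t x) :> R.
  by rewrite sumr_ge0 // => t _; rewrite subr_ge0 ler_norm.
have mcont : continuous (m \o psiVL : 'rV[R]_n -> R).
  have lcont t : continuous (fun x => l t (psiVL x) : R).
    exact: (@functional_continuous R n (l t \o psiVL)).
  have ncont t : continuous (fun x => `|l t (psiVL x)| : R).
    by move=> x; apply: continuous_comp; [exact: lcont|exact: norm_continuous].
  have c1 : continuous (fun x => \sum_t (`|l t (psiVL x)| - l t (psiVL x)) : R).
    apply: continuous_big => [|t _ y]; first exact: add_continuous.
    exact: cvgB (ncont t y) (lcont t y).
  have c2 : continuous (fun x => \sum_(t | tight t) `|l t (psiVL x)| : R).
    by apply: continuous_big => [|t _]; [exact: add_continuous | exact: ncont].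
  by move=> x; exact: cvgD (c1 x) (c2 x).
have mZ a x : 0 <= a -> (m \o psiVL) (a *: x) = a * (m \o psiVL) x.
  move=> a0; rewrite -[LHS]/(m (psiVL (a *: x))).
  rewrite -[(m \o psiVL) x]/(m (psiVL x)) linearZ /m mulrDr !mulr_sumr.
  by congr (_ + _); apply: eq_bigr => t _;
    rewrite (functionalZ (l t)) normrM (ger0_norm a0) ?mulrBr.
have m_gt0 x : x != 0 -> 0 < (m \o psiVL) x.
  move=> x0; rewrite -[(m \o psiVL) x]/(m (psiVL x)) /m.
  rewrite lt_neqAle addr_ge0 ?m_ge0 ?sumr_ge0 // andbT eq_sym.
  apply/negP; rewrite paddr_eq0 ?m_ge0 ?sumr_ge0 //.
  rewrite !psumr_eq0 //; last by move=> t _; rewrite subr_ge0 ler_norm.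
  move=> /andP[/allP xK /allP xt]; apply: irr.
  set w := psiVL x in xK xt.
  have wK : ineq_cone w.
    move=> t; have := xK t; rewrite mem_index_enum subr_eq0 => /(_ isT)/eqP <-.
    exact: normr_ge0.
  have wt t : tight t -> l t w = 0.
    by move=> tt; have := xt t; rewrite mem_index_enum tt normr_eq0 =>
      /(_ isT)/eqP.
  have [|e e0 ew] := @small_multiple_le R T
    (fun t => if tight t then 1 else Num.min (l t g) (l t h))
    (fun t => l t w).
    move=> t; case: ifPn; rewrite // negb_or => /andP[gt ht].
    by rewrite lt_min !lt_neqAle ![0 == _]eq_sym gt ht gK hK.
  have shiftK p : ineq_cone p -> (forall t, ~~ tight t -> e * l t w <= l t p) ->
      ineq_cone (p - e *: w).
    move=> pK pe t; rewrite linearB (functionalZ (l t)) subr_ge0.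
    by have [/wt ->|/pe //] := boolP (tight t); rewrite mulr0; exact: pK.
  exists (e *: w); split => [t||/=|/=].
  - by rewrite (functionalZ (l t)); apply: mulr_ge0; [exact: ltW|exact: wK].
  - move=> /eqP; rewrite scaler_eq0 gt_eqF //= => /eqP w0.
    by move: x0; rewrite -[x]psiVK (w0 : psiV x = 0) linear0 eqxx.
  - apply: shiftK => // t /negPf tt; have := ew t.
    by rewrite tt le_min => /andP[].
  - apply: shiftK => // t /negPf tt; have := ew t.
    by rewrite tt le_min => /andP[].
have [delta delta0 mdelta] := gauge_bounds_norm mcont mZ m_gt0.
(* On [F] only the tight terms of [m p] remain: those tight at [g] vanish, and
   those tight at [h] are constant because [p = q + f] and [l t q = 0]. *)
have Fbnd p q : F (p, q) -> m p <= \sum_t `|l t f|.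
  move=> Fpq; have [[pK qK /= fpq] _] := Fpq; have [pt qt] := Ftight _ _ Fpq.
  rewrite mE // [leRHS](bigID tight) /= -[leLHS]addr0 lerD ?sumr_ge0 //.
  apply: ler_sum => t /orP[/eqP/pt ->|/eqP/qt qt0]; first by rewrite normr0.
  by rewrite fpq linearB qt0 subr0.
exists F; split.
- by exists c, 0.
- exists (n + n)%N.
  have psi2_lin : linear (fun pq : W * W => row_mx (psi pq.1) (psi pq.2)).
    by move=> a x y; rewrite !linearP /= scale_row_mx add_row_mx.
  exists (pack_linear psi2_lin); split.
    exists (fun r => (psiV (lsubmx r), psiV (rsubmx r))).
      by move=> [p q] /=; rewrite row_mxKl row_mxKr !psiK.
    by move=> r /=; rewrite !psiVK hsubmxK.
  pose N := (\sum_t `|l t f|) / delta.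
  have pN p q : F (p, q) -> `|psi p| <= N.
    move=> /Fbnd mp; rewrite ler_pdivlMr // mulrC (le_trans (mdelta _)) //=.
    by rewrite psiK.
  exists (N + (N + `|psi f|)); split; first by rewrite num_real.
  move=> M NM _ [[p q] Fpq <-] /=; apply: le_trans (ltW NM).
  apply: le_trans (norm_row_mx_le _ _) _; apply: lerD; first exact: pN Fpq.
  have [[_ _ /= fpq] _] := Fpq.
  have -> : q = p - f by rewrite fpq opprB addrCA subrr addr0.
  rewrite linearB (le_trans (ler_normB _ _)) // lerD2r; exact: pN Fpq.
- split=> //=; apply/eqP; rewrite oppr_eq0 !big1 ?addr0 // => t /eqP //.
Qed.

End cone_decompositions.

(** * Convexity of compatible functions *)

Section full_cells.
Variables (R : realType) (d : nat) (C : polyComplex R d).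
Implicit Types (P Q : set 'rV[R]_d) (a b : 'rV[R]_d -> R^o) (u : cpwlSpace C).

Definition full_cell P := cells C P /\ affine_hull P = setT.

Definition agree_on P (u a : 'rV[R]_d -> R^o) := forall y, P y -> u y = a y.

Lemma has_dim_full P : has_dim P d -> affine_hull P = setT.
Proof.
move=> [p [U [-> dimU]]].
have /eqP -> : U == fullv.
  by rewrite eqEdim subvf dimvf dimU dim_matrix; exact: eq_leq (mul1n d).
by apply/seteqP; split=> // x _; exact: memvf.
Qed.

(** A maximal cell containing [x] is full-dimensional by purity.  Maximality is
    reached by counting the cells below a given one. *)
Lemma full_cells_cover x : exists2 P, full_cell P & P x.
Proof.
have /finite_seqP[s sE] := cells_finite C.
pose below P : {set 'I_(size s)} :=
  [set i : 'I_(size s) | `[< nth set0 s i `<=` P >]]%SET.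
have belowP (i : 'I_(size s)) P : reflect (nth set0 s i `<=` P) (i \in below P).
  by rewrite inE; exact: asboolP.
pose hit k := `[< exists P, [/\ cells C P, P x & #|below P| = k] >].
have ex_hit : exists k, hit k.
  have : (\bigcup_(P in cells C) P) x by rewrite cells_complete.
  by move=> [P CP Px]; exists #|below P|; apply/asboolP; exists P.
have hit_le k : hit k -> (k <= size s)%N.
  by move=> /asboolP[P [_ _ <-]]; rewrite -[leqRHS]card_ord max_card.
case: (ex_maxnP ex_hit hit_le) => k /asboolP[P [CP Px Pk]] kmax.
exists P => //; split => //; apply/has_dim_full/(cells_pure CP) => Q CQ PQ.
apply: contrapT => QP; suff /kmax : hit #|below Q|.
  rewrite -Pk leqNgt => /negP; apply; apply: proper_card.
  rewrite properE; apply/andP; split.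
    by apply/fintype.subsetP => i /belowP iP; exact/belowP/(subset_trans iP).
  have Qs : (index Q s < size s)%N by rewrite index_mem; move: CQ; rewrite sE.
  have QE : nth set0 s (Ordinal Qs) = Q by rewrite /= nth_index // -index_mem.
  apply/fintype.subsetPn; exists (Ordinal Qs).
    by apply/belowP; rewrite QE.
  by apply/belowP; rewrite QE => QP'; apply: QP; exact/seteqP.
by apply/asboolP; exists Q; split=> //; exact: PQ.
Qed.

Lemma full_cells_enum : exists (n : nat) (P : 'I_n -> set 'rV[R]_d),
  (forall i, full_cell (P i)) /\ forall Q, full_cell Q -> exists i, Q = P i.
Proof.
have /finite_seqP[s sE] := cells_finite C.
pose s' := [seq P <- s | `[< full_cell P >]].
exists (size s'), (fun i => nth set0 s' i); split=> [i|Q QC].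
  by have := mem_nth set0 (ltn_ord i); rewrite mem_filter => /andP[/asboolP].
have Qs : Q \in s'.
  rewrite mem_filter; apply/andP; split; first exact/asboolP.
  by case: QC; rewrite sE.
by exists (Ordinal (etrans (index_mem Q s') Qs)); rewrite /= nth_index.
Qed.

Lemma cpwl_affine P u : full_cell P -> exists2 a, affine_fun a & agree_on P u a.
Proof. by move=> [CP _]; have /asboolP := cpwl_funP u; apply. Qed.

Lemma affine_sum a n (w : 'I_n -> R) (p : 'I_n -> 'rV[R]_d) :
  affine_fun a -> \sum_i w i = 1 ->
  a (\sum_i w i *: p i) = \sum_i w i * a (p i).
Proof.
move=> [l [e aE]] w1; rewrite aE linear_sum.
rewrite [RHS](eq_bigr (fun i => w i * l (p i) + w i * e)) => [|i _]; last first.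
  by rewrite aE mulrDr.
rewrite big_split /= -mulr_suml w1 mul1r; congr (_ + _).
by apply: eq_bigr => i _; exact: functionalZ.
Qed.

(** [x] is an affine combination of points of [P], and the same combination of
    the values of [u] gives the value at [x] of any affine function that agrees
    with [u] on [P]; this formula is visibly linear in [u]. *)
Lemma extension_functional P x : full_cell P ->
  exists l : {linear cpwlSpace C -> R^o},
    forall u a, affine_fun a -> agree_on P u a -> l u = a x.
Proof.
move=> [_ Pfull]; have : affine_hull P x by rewrite Pfull.
move=> [n [w [p [Pp w1 ->]]]].
have l_lin : linear (fun u : cpwlSpace C =>
    \sum_i w i * cpwl_fun u (p i) : R^o).
  move=> k u v; rewrite scaler_sumr -big_split /=; apply: eq_bigr => i _.
  transitivity (w i * (k * cpwl_fun u (p i) + cpwl_fun v (p i))); first by [].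
  by rewrite /GRing.scale /=; ring.
exists (pack_linear l_lin) => u a aaff ua; rewrite affine_sum //=.
by apply: eq_bigr => i _; rewrite ua.
Qed.

Lemma polyhedron_convex P n (w : 'I_n -> R) (p : 'I_n -> 'rV[R]_d) :
  is_polyhedron P -> (forall i, P (p i)) -> (forall i, 0 <= w i) ->
  \sum_i w i = 1 -> P (\sum_i w i *: p i).
Proof.
move=> [k [l [c ->]]] Pp w0 w1 j.
rewrite linear_sum -[leRHS]mul1r -w1 mulr_suml.
by apply: ler_sum => i _; rewrite (functionalZ (l j)) ler_wpM2l //; exact: Pp.
Qed.

Lemma convex_funP (u : 'rV[R]_d -> R^o) :
  @convex_function R 'rV[R]_d setT u <->
  forall t x y, 0 <= t -> t <= 1 ->
    u (t *: x + (1 - t) *: y) <= t * u x + (1 - t) * u y.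
Proof.
split=> [uconv t x y t0 t1|uconv t x y _ _].
  by have := uconv (Itv01 t0 t1) x y; rewrite !in_setT => /(_ isT isT).
exact: uconv.
Qed.

(** Write [x] as an affine combination of points of [P] with barycenter [y]. The
    points of the segment from [y] to [x] that are close to [y] are convex
    combinations of these points, hence lie in [P], where [u] is affine; a
    convex function lies above its linear extrapolation. *)
Lemma convex_above P a (u : 'rV[R]_d -> R^o) x : full_cell P ->
  @convex_function R 'rV[R]_d setT u -> affine_fun a -> agree_on P u a ->
  a x <= u x.
Proof.
move=> [CP Pfull] /convex_funP uconv aaff ua.
have : affine_hull P x by rewrite Pfull.
move=> [n [w [p [Pp w1 xE]]]].
have n0 : (0 < n)%N.
  case: n w p Pp w1 xE => // w p _; rewrite big_ord0 => /esym/eqP.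
  by rewrite oner_eq0.
have n0' : 0 < n%:R^-1 :> R by rewrite invr_gt0 ltr0n.
(* The index [None] asks for [t <= 1], and the index [Some i] for a nonnegative
   weight of [p i] in [t *: x + (1 - t) *: y]. *)
have [|t t0 tw] := @small_multiple_le R (option 'I_n)
    (fun o => if o is Some i then n%:R^-1 else 1)
    (fun o => if o is Some i then n%:R^-1 - w i else 1).
  by case.
have t1 : t <= 1 by have := tw None; rewrite mulr1.
pose v (i : 'I_n) : R := n%:R^-1.
have v1 : \sum_i v i = 1.
  by rewrite /v sumr_const card_ord -[LHS]mulr_natr mulVf // pnatr_eq0 -lt0n.
pose y := \sum_i v i *: p i.
have Py : P y.
  by apply: polyhedron_convex => // [|i];
    [exact: (cells_polyhedron CP)|exact: ltW].
have Pz : P (t *: x + (1 - t) *: y).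
  rewrite xE /y !scaler_sumr -big_split /=.
  rewrite (eq_bigr (fun i => (t * w i + (1 - t) * v i) *: p i)) => [|i _];
    last by rewrite !scalerA -scalerDl.
  apply: polyhedron_convex => // [|i|]; first exact: (cells_polyhedron CP).
    have := tw (Some i); rewrite -subr_ge0; congr (_ <= _); rewrite /v; ring.
  by rewrite big_split /= -!mulr_sumr w1 v1; ring.
have := uconv t x y (ltW t0) t1.
have [l [e aE]] := aaff.
rewrite (ua _ Pz) (ua _ Py) !aE functionalP (functionalZ l) => h.
rewrite -(ler_pM2l t0) -subr_ge0; move: h; rewrite -subr_ge0.
by congr (_ <= _); ring.
Qed.

(** One direction is [convex_above].  For the other one, if all the affine
    pieces lie below [u], then at a convex
    combination, which lies in some full cell, [u] agrees with an affine
    function that is below [u] at the end points. *)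
Lemma convex_fullP u : @convex_function R 'rV[R]_d setT u <->
  forall P a, full_cell P -> affine_fun a -> agree_on P u a ->
    forall x, a x <= u x.
Proof.
split=> [uconv P a Pfull aaff ua x|above].
  by apply: (convex_above (P := P)).
apply/convex_funP => t x y t0 t1.
have [P Pfull Pz] := full_cells_cover (t *: x + (1 - t) *: y).
have [a aaff ua] := cpwl_affine u Pfull; rewrite ua //.
have [l [e aE]] := aaff.
have ax := above P a Pfull aaff ua x; have ay := above P a Pfull aaff ua y.
apply: (@le_trans _ _ (t * a x + (1 - t) * a y)).
  rewrite !aE functionalP (functionalZ l) le_eqVlt; apply/orP; left.
  by apply/eqP; ring.
by rewrite lerD // ler_wpM2l // subr_ge0.
Qed.

Lemma convex_cone_cls u :
  convex_cone (cls u) <-> @convex_function R 'rV[R]_d setT u.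
Proof.
split=> [[v vconv /clsP[l [e uvE]]]|uconv]; last by exists u.
have uE x : u x = v x + (l x + e) by rewrite -uvE addrC subrK.
apply/convex_funP => t x y t0 t1; move/convex_funP in vconv.
rewrite !uE functionalP (functionalZ l).
have := vconv t x y t0 t1; rewrite -subr_ge0 => h; rewrite -subr_ge0; move: h.
by congr (_ <= _); ring.
Qed.

(** Representatives of a class differ by an affine function. *)
Lemma quotient_functional (l : {linear cpwlSpace C -> R^o}) :
  (forall u, affine_fun u -> l u = 0) ->
  exists l' : {linear cpwlQuot C -> R^o}, forall u, l' (cls u) = l u.
Proof.
move=> l0.
have lE u v : cls u = cls v -> l u = l v.
  by move=> /clsP /l0 /eqP; rewrite linearB subr_eq0 => /eqP.
have l_lin : linear (l \o @rep R d C).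
  move=> k p q; rewrite -[RHS]functionalP; apply: lE.
  apply: etrans (repK _) _; apply/esym; rewrite linearP.
  by congr (_ *: _ + _); exact: repK.
exists (pack_linear l_lin) => u; apply: lE; exact: repK.
Qed.

(** The difference at [x] of the affine pieces of [u] on two cells depends only
    on the class of [u], since adding an affine function changes both pieces
    equally. *)
Lemma gap_functional P Q x : full_cell P -> full_cell Q ->
  exists B : {linear cpwlQuot C -> R^o},
    forall u a b, affine_fun a -> affine_fun b ->
      agree_on P u a -> agree_on Q u b -> B (cls u) = b x - a x.
Proof.
move=> Pfull Qfull.
have [lP lPE] := extension_functional x Pfull.
have [lQ lQE] := extension_functional x Qfull.
have lPQ_lin : linear (fun u => lQ u - lP u : R^o).
  by move=> k u v; rewrite !functionalP /GRing.scale /=; ring.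
have [|B BE] := @quotient_functional (pack_linear lPQ_lin).
  by move=> u uaff /=; rewrite (lPE u u) // (lQE u u) // subrr.
exists B => u a b aaff baff ua ub; rewrite BE /=.
by rewrite (lPE u a) // (lQE u b).
Qed.

Lemma gap_functionals n (P : 'I_n -> set 'rV[R]_d) :
  (forall i, full_cell (P i)) ->
  exists B : 'I_n -> 'I_n -> 'rV[R]_d -> {linear cpwlQuot C -> R^o},
    forall i j x u a b, affine_fun a -> affine_fun b ->
      agree_on (P i) u a -> agree_on (P j) u b -> B i j x (cls u) = b x - a x.
Proof.
move=> Pfull.
have [B BE] := choice (fun z : 'I_n * 'I_n * 'rV[R]_d =>
  gap_functional z.2 (Pfull z.1.1) (Pfull z.1.2)).
by exists (fun i j x => B (i, j, x)) => i j x u a b; exact: (BE (i, j, x)).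
Qed.

(** Convexity means that each affine piece stays below [u]; on the cell [P j],
    where [u] is the piece [j], this is a family of inequalities that
    [polyhedron_test] makes finite. *)
Lemma convex_cone_ineqs : exists (T : finType)
    (l : T -> {linear cpwlQuot C -> R^o}), @convex_cone R d C = ineq_cone l.
Proof.
have [n [P [Pfull Pall]]] := full_cells_enum.
have [B BE] := gap_functionals Pfull.
have Baff i j q : affine_fun (fun x => B i j x q).
  have [a aaff ua] := cpwl_affine (rep q) (Pfull i).
  have [b baff ub] := cpwl_affine (rep q) (Pfull j).
  rewrite (_ : (fun x => _) = (-1) *: a + b); first exact: affine_fun_lin.
  apply/funext => x; rewrite -{1}[q]repK (BE _ _ _ _ a b) //.
  by rewrite scaleN1r addrC.
have test (ij : 'I_n * 'I_n) :
    exists t : {m & 'I_m -> {linear cpwlQuot C -> R^o}},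
    forall q, (forall x, P ij.2 x -> 0 <= B ij.1 ij.2 x q) <->
      (forall k, 0 <= projT2 t k q).
  have [|m [l lE]] :=
    @polyhedron_test R d _ (P ij.2) (B ij.1 ij.2) _ (Baff _ _).
    exact: (cells_polyhedron (Pfull ij.2).1).
  by exists (existT _ m l).
have {test} [L LE] := choice test.
exists {ij : 'I_n * 'I_n & 'I_(projT1 (L ij))}.
exists (fun t => projT2 (L (tag t)) (tagged t)).
suff coneE q : convex_cone q <-> forall i j x, P j x -> 0 <= B i j x q.
  apply/seteqP; split => [q /coneE qB [ij k] /=|q qL].
    by apply: (LE ij q).1 => x; exact: qB.
  apply/coneE => i j; apply: (LE (i, j) q).2 => k.
  exact: (qL (Tagged (fun ij => 'I_(projT1 (L ij))) k)).
rewrite -[q]repK convex_cone_cls convex_fullP.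
split=> [above i j x Px|B_ge0 Q a Qfull aaff ua x].
  have [a aaff ua] := cpwl_affine (rep q) (Pfull i).
  have [b baff ub] := cpwl_affine (rep q) (Pfull j).
  by rewrite (BE _ _ _ _ a b) // subr_ge0 -ub // (above (P i)).
have [P' P'full P'x] := full_cells_cover x.
have [i QE] := Pall _ Qfull; have [j P'E] := Pall _ P'full.
rewrite {}QE in ua; rewrite {}P'E in P'x.
have [b baff ub] := cpwl_affine (rep q) (Pfull j).
have := B_ge0 i j x P'x.
by rewrite (BE _ _ _ _ a b) // subr_ge0 -ub.
Qed.

(** The origin and the canonical basis form an affine basis. *)
Lemma affine_fun_ext a b : affine_fun a -> affine_fun b ->
  a 0 = b 0 -> (forall k, a (delta_mx 0 k) = b (delta_mx 0 k)) -> a = b.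
Proof.
move=> [l [e aE]] [m [c bE]]; rewrite aE bE !linear0 !add0r => ec abk.
apply/funext => x; rewrite aE bE ec; congr (_ + _).
rewrite [x]row_sum_delta !linear_sum; apply: eq_bigr => k _.
rewrite (functionalZ l) (functionalZ m); congr (_ * _).
by have := abk k; rewrite aE bE ec => /addIr.
Qed.

(** A class is zero as soon as all the affine pieces of a representative
    coincide with the one on a fixed full cell; this is tested by the gaps at
    the points of an affine basis, in finite number. *)
Lemma cpwlQuot_coordinates :
  exists (m : nat) (phi : {linear cpwlQuot C -> 'rV[R]_m}), bijective phi.
Proof.
have [n [P [Pfull Pall]]] := full_cells_enum.
have [B BE] := gap_functionals Pfull.
have [P0 P0full _] := full_cells_cover 0; have [i0 _] := Pall _ P0full.
apply: (@coordinates_of_separating _ _ ('I_n * option 'I_d)%type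
  (fun t => B i0 t.1 (if t.2 is Some k then delta_mx 0 k else 0))) => q Bq.
have [a aaff ua] := cpwl_affine (rep q) (Pfull i0).
suff uE x : rep q x = a x.
  rewrite -[q]repK -[RHS](linear0 (@cls R d C)); apply/clsP.
  rewrite subr0 (_ : cpwl_fun _ = a) //; exact/funext.
have [P' P'full P'x] := full_cells_cover x.
have [j P'E] := Pall _ P'full; rewrite {}P'E in P'x.
have [b baff ub] := cpwl_affine (rep q) (Pfull j).
have Bab t : b (if t is Some k then delta_mx 0 k else 0) =
             a (if t is Some k then delta_mx 0 k else 0).
  apply/eqP; rewrite -subr_eq0 -(BE i0 j _ (rep q) a b) // repK.
  by apply/eqP; exact: (Bq (j, t)).
rewrite ub //; congr (_ x); apply: affine_fun_ext => //; first exact: Bab None.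
by move=> k; exact: Bab (Some k).
Qed.

End full_cells.

Lemma decomposition_polyhedronE (R : realType) (d : nat) (C : polyComplex R d)
    (u : cpwlSpace C) (T : finType) (l : T -> {linear cpwlQuot C -> R^o}) :
  @convex_cone R d C = ineq_cone l ->
  decomposition_polyhedron C u = cone_decompositions l (cls u).
Proof.
move=> coneE; rewrite /decomposition_polyhedron coneE.
apply/seteqP; split=> -[g h] [gK hK uE]; split=> //=.
  by case: uE => v /val_inj <-.
by exists u.
Qed.

Theorem theorem4p5 (R : realType) (d : nat) (f : 'rV[R]_d -> R^o)
    (C : polyComplex R d) (g h : cpwlQuot C) :
  cpwl f ->
  decomposition_polyhedron C f (g, h) ->
  (reduced (g, h) <->
   exists F : set (cpwlQuot C * cpwlQuot C)%type,
     [/\ is_face (decomposition_polyhedron C f) F, bounded_in_coord F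
       & F (g, h)]).
Proof.
move=> _ Dgh; have [_ _ [u uf _]] := Dgh.
have [T [l coneE]] := convex_cone_ineqs C.
have [m [phi phi_bij]] := cpwlQuot_coordinates C.
move: Dgh; rewrite -uf (decomposition_polyhedronE u coneE) => Dgh.
rewrite /reduced coneE; split=> [|[F [Fface Fbnd Fgh]]].
  exact: reduced_bounded_face phi_bij Dgh.
exact: bounded_face_reduced Fface Fbnd Fgh.
Qed.
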